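(* Let $n\ge 0$, let $\Pi=\{0,1,\dots,n\}$, let $\mathcal{A}$ be a superset-closed adversary on $\Pi$, and let $k$ be a positive integer. If $k<\mathit{csize}(\mathcal{A})$, then the $k$-set agreement task $\mathcal{I}[\mathcal{SA}_k]$ is not solvable by the protocol $\mathcal{I}[\mathcal{R}_{\mathcal{A}}]$ (a single round of the round operator); that is, there is no morphism $\delta:\mathcal{I}[\mathcal{R}_{\mathcal{A}}]\to\mathcal{I}[\mathcal{SA}_k]$ with $\pi_{\mathcal{I}}\circ\delta=\pi_{\mathcal{I}}$.
   Context: Complexes. A (pure, chromatic, $n$-dimensional) complex is a family $\mathcal{C}$ of finite sets of vertexes (simplexes), closed under taking subsets, all of whose facets (inclusion-maximal simplexes) have exactly $n+1$ vertexes, with a coloring $\chi$ assigning to each vertex a color in $\Pi$ so that distinct vertexes of the same simplex have distinct colors. It is determined by its set of facets $\mathsf{F}(\mathcal{C})$. Vertexes written as pairs $(a,v)$ have color $a$. A color-preserving simplicial map $\mathcal{C}\to\mathcal{D}$ is a map on vertexes preserving colors and sending simplexes to simplexes (hence facets to facets). Products. For facets $X$ of $\mathcal{C}$ and $Y$ of $\mathcal{D}$, $X\times Y=\{(u,v)\mid u\in X, v\in Y, \chi(u)=\chi(v)\}$, where $(u,v)$ has color $\chi(u)$. $\mathcal{C}\times\mathcal{D}$ is the complex whose facets are all such $X\times Y$; $\pi_{\mathcal{C}}((u,v))=u$ is the projection. Initial model. $\mathcal{I}$ is the complex whose facets are all sets $\{(0,v_0),\dots,(n,v_n)\}$ with $v_0,\dots,v_n\in\Pi$;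 a facet $X$ is labelled by the set of atomic propositions $L(X)=\{\mathsf{input}_a^v\mid (a,v)\in X\}$. Task. $\mathcal{SA}_k$ is the complex whose facets are $\langle d_0,\dots,d_n\rangle=\{(0,d_0),\dots,(n,d_n)\}$ with $d_0,\dots,d_n\in\Pi$ and $|\{d_0,\dots,d_n\}|\le k$. $\mathcal{I}[\mathcal{SA}_k]$ is the subcomplex of $\mathcal{I}\times\mathcal{SA}_k$ whose facets are the products $X\times\langle d_0,\dots,d_n\rangle$ such that for every $a\in\Pi$ there is $a'\in\Pi$ with $(a',d_a)\in X$. Its labelling is $L(X\times\vec d)=L(X)$. Adversaries. A superset-closed adversary is a nonempty set $\mathcal{A}\subseteq 2^{\Pi}$ with $\emptyset\notin\mathcal{A}$ such that $P\in\mathcal{A}$ and $P\subseteq P'\subseteq\Pi$ imply $P'\in\mathcal{A}$. A core of $\mathcal{A}$ is an inclusion-minimal set $C\subseteq\Pi$ with $C\cap P\ne\emptyset$ for every $P\in\mathcal{A}$. $\mathit{csize}(\mathcal{A})$ is the minimum cardinality of a core of $\mathcal{A}$. Protocol. $\mathcal{R}_{\mathcal{A}}$ is the complex whose facets are $X^{\langle S_0,\dots,S_n\rangle}=\{(a,\mathit{view}_a)\mid a\in\Pi\}$ with $\mathit{view}_a=\{u\in X\mid\chi(u)\in S_a\}$, where $X$ is a facet of $\mathcal{I}$ and $S_0,\dots,S_n\subseteq\Pi$ satisfy: $S_a\in\mathcal{A}$ for each $a\in\Pi$; $a\in S_a$ for each $a\in\Pi$; and $S_a\subseteq S_{a'}$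 or $S_a\supseteq S_{a'}$ for all $a,a'\in\Pi$. $\mathcal{I}[\mathcal{R}_{\mathcal{A}}]$ is the subcomplex of $\mathcal{I}\times\mathcal{R}_{\mathcal{A}}$ whose facets are the products $X\times X^{\langle S_0,\dots,S_n\rangle}$, with labelling $L(X\times X^{\vec S})=L(X)$. Morphism. A morphism between such labelled complexes is a color-preserving simplicial map $\delta$ such that $L(\delta(Z))=L(Z)$ for every facet $Z$ of the source. On both $\mathcal{I}[\mathcal{R}_{\mathcal{A}}]$ and $\mathcal{I}[\mathcal{SA}_k]$, $\pi_{\mathcal{I}}$ denotes the projection to $\mathcal{I}$. *)

(* Defs.v *)
From mathcomp Require Import all_boot.

Set Implicit Arguments.
Unset Strict Implicit.
Unset Printing Implicit Defensive.

(* Processes are the elements of Pi = 'I_n.+1 = {0, ..., n}. *)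

Section Complexes.
Variable n : nat.

(* [V] is only an ambient type: the vertexes of [C] are the elements of
   [vertexes C], and [color C] is irrelevant outside [vertexes C]. *)
Record complex (V : finType) := Complex {
  simplexes : {set {set V}};
  color : V -> 'I_n.+1;
  complex_down : forall S T : {set V},
    S \in simplexes -> T \subset S -> T \in simplexes;
  complex_pure : forall X : {set V},
    maxset [pred S | S \in simplexes] X -> #|X| = n.+1;
  complex_chromatic : forall S : {set V},
    S \in simplexes -> {in S &, injective color} }.

Definition facets (V : finType) (C : complex V) : {set {set V}} :=
  [set X | maxset [pred S | S \in simplexes C] X].

Definition vertexes (V : finType) (C : complex V) : {set V} :=
  cover (simplexes C).

Section OfFacets.
Variables (V : finType) (chi : V -> 'I_n.+1) (F : {set {set V}}).
Hypothesis cardF : forall X, X \in F -> #|X| = n.+1.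
Hypothesis chiF : forall X, X \in F -> {in X &, injective chi}.

Definition downset : {set {set V}} :=
  [set S : {set V} | [exists X in F, S \subset X]].

Lemma downsetP (S : {set V}) : reflect (exists2 X, X \in F & S \subset X) (S \in downset).
Proof. by rewrite inE; apply: (iffP exists_inP). Qed.

Lemma maxset_downset (X : {set V}) :
  maxset [pred S | S \in downset] X = (X \in F).
Proof.
apply/idP/idP => [/maxsetP[/downsetP[Y FY sXY] maxX]|FX].
  rewrite -(maxX Y) //; apply/downsetP; by exists Y.
apply/maxsetP; split=> [|Y /downsetP[Z FZ sYZ] sXY].
  by apply/downsetP; exists X.
apply/eqP; rewrite eq_sym eqEcard sXY (cardF FX) /=.
by rewrite -(cardF FZ) subset_leq_card.
Qed.

Fact downset_down (S T : {set V}) :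
  S \in downset -> T \subset S -> T \in downset.
Proof.
case/downsetP=> X FX sSX sTS; apply/downsetP.
by exists X; last exact: subset_trans sSX.
Qed.

Fact downset_pure (X : {set V}) : maxset [pred S | S \in downset] X -> #|X| = n.+1.
Proof. by rewrite maxset_downset; apply: cardF. Qed.

Fact downset_chromatic (S : {set V}) :
  S \in downset -> {in S &, injective chi}.
Proof.
case/downsetP=> X FX sSX u v /(subsetP sSX) Xu /(subsetP sSX) Xv.
exact: (chiF FX).
Qed.

Definition of_facets : complex V :=
  Complex downset_down downset_pure downset_chromatic.

Lemma facets_of_facets : facets of_facets = F.
Proof. by apply/setP=> X; rewrite inE maxset_downset. Qed.

End OfFacets.

Section Facets.
Variables (V : finType) (C : complex V).

Lemma facet_simplex X : X \in facets C -> X \in simplexes C.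
Proof. by rewrite inE => /maxsetp. Qed.

Lemma card_facet X : X \in facets C -> #|X| = n.+1.
Proof. by rewrite inE; apply: complex_pure. Qed.

Lemma facet_inj X : X \in facets C -> {in X &, injective (color C)}.
Proof. by move/facet_simplex; apply: complex_chromatic. Qed.

Lemma facet_surj X a : X \in facets C -> exists2 u, u \in X & color C u = a.
Proof.
move=> FX; have im : color C @: X = setT.
  apply/eqP; rewrite eqEcard subsetT cardsT card_ord.
  by rewrite (card_in_imset (facet_inj FX)) (card_facet FX) leqnn.
have: a \in color C @: X by rewrite im inE.
by case/imsetP=> u Xu ->; exists u.
Qed.

(* The subcomplex of [C] spanned by a set [F] of facets of [C]. *)
Definition subcomplex (F : {set {set V}}) (sF : F \subset facets C) :
  complex V :=
  @of_facets V (color C) F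
    (fun X FX => card_facet (subsetP sF X FX))
    (fun X FX => facet_inj (subsetP sF X FX)).

Lemma facets_subcomplex (F : {set {set V}}) (sF : F \subset facets C) :
  facets (subcomplex sF) = F.
Proof. exact: facets_of_facets. Qed.

End Facets.

Section Product.
Variables (V W : finType) (C : complex V) (D : complex W).

Definition prod_facet (X : {set V}) (Y : {set W}) : {set V * W} :=
  [set z | [&& z.1 \in X, z.2 \in Y & color C z.1 == color D z.2]].

Definition prod_color (z : V * W) : 'I_n.+1 := color C z.1.

Definition prod_facets : {set {set V * W}} :=
  [set prod_facet X Y | X in facets C, Y in facets D].

Lemma fst_prod_facet X Y : X \in facets C -> Y \in facets D ->
  [set z.1 | z in prod_facet X Y] = X.
Proof.
move=> FX FY; apply/setP=> u; apply/imsetP/idP => [[z]|Xu].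
  by rewrite inE => /and3P[Xz _ _] ->.
have [v Yv cv] := facet_surj (color C u) FY.
by exists (u, v); rewrite // inE /= Xu Yv cv eqxx.
Qed.

Fact fst_prod_facet_inj X Y : X \in facets C -> Y \in facets D ->
  {in prod_facet X Y &, injective fst}.
Proof.
move=> FX FY [u v] [u' v']; rewrite !inE /=.
case/and3P=> _ Yv /eqP cv /and3P[_ Yv' /eqP cv'] equ; subst u'.
by congr (_, _); apply: (facet_inj FY) => //; rewrite -cv -cv'.
Qed.

Fact card_prod_facets Z : Z \in prod_facets -> #|Z| = n.+1.
Proof.
case/imset2P=> X Y FX FY ->.
rewrite -(card_in_imset (fst_prod_facet_inj FX FY)).
by rewrite (fst_prod_facet FX FY) (card_facet FX).
Qed.

Fact prod_facets_inj Z : Z \in prod_facets -> {in Z &, injective prod_color}.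
Proof.
case/imset2P=> X Y FX FY -> z z' Zz Zz' eqc.
apply: (fst_prod_facet_inj FX FY) => //; apply: (facet_inj FX) => //.
  by move: Zz; rewrite inE => /and3P[].
by move: Zz'; rewrite inE => /and3P[].
Qed.

Definition prod_complex : complex (V * W)%type :=
  of_facets card_prod_facets prod_facets_inj.

Lemma facets_prod : facets prod_complex = prod_facets.
Proof. exact: facets_of_facets. Qed.

End Product.

Section GraphComplex.
Variable T : finType.

(* {(0, f 0), ..., (n, f n)} *)
Definition graph (f : {ffun 'I_n.+1 -> T}) : {set 'I_n.+1 * T} :=
  [set (a, f a) | a : 'I_n.+1].

Variable P : {set {ffun 'I_n.+1 -> T}}.

Fact card_graph Z : Z \in graph @: P -> #|Z| = n.+1.
Proof.
by case/imsetP=> f _ ->; rewrite card_imset ?card_ord // => a b [].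
Qed.

Fact graph_chromatic Z : Z \in graph @: P -> {in Z &, injective fst}.
Proof.
by case/imsetP=> f _ -> _ _ /imsetP[a _ ->] /imsetP[b _ ->] /= ->.
Qed.

Definition graph_complex : complex ('I_n.+1 * T)%type :=
  of_facets card_graph graph_chromatic.

Lemma facets_graph : facets graph_complex = graph @: P.
Proof. exact: facets_of_facets. Qed.

End GraphComplex.

(* The atomic proposition input_a^v is encoded as the pair (a, v). *)
Definition atom : finType := ('I_n.+1 * 'I_n.+1)%type.
Definition input (a v : 'I_n.+1) : atom := (a, v).

(* Only the values of [label] on facets are meaningful. *)
Record labelled (V : finType) := Labelled {
  carrier :> complex V;
  label : {set V} -> {set atom} }.

(* Only the values of [delta] on the vertexes of [C] are meaningful. *)
Definition morphism (V W : finType) (C : labelled V) (D : labelled W)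
    (delta : V -> W) : Prop :=
  [/\ {in vertexes C, forall z, color D (delta z) = color C z},
      {in simplexes C, forall S : {set V}, delta @: S \in simplexes D}
    & {in facets C, forall Z : {set V}, label D (delta @: Z) = label C Z}].

Definition initial : complex ('I_n.+1 * 'I_n.+1)%type := graph_complex setT.

Definition initial_label (X : {set 'I_n.+1 * 'I_n.+1}) : {set atom} :=
  [set input u.1 u.2 | u in X].

(* L(X * Y) = L(X), where X is recovered from Z = X * Y as pi_I(Z);
   see [product_labelE]. *)
Definition product_label (W : finType)
    (Z : {set ('I_n.+1 * 'I_n.+1) * W}) : {set atom} :=
  initial_label [set z.1 | z in Z].

Lemma product_labelE (W : finType) (D : complex W) X Y :
  X \in facets initial -> Y \in facets D ->
  product_label (prod_facet initial D X Y) = initial_label X.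
Proof. by move=> FX FY; rewrite /product_label fst_prod_facet. Qed.

(* The underlying complexes have vertexes (u, v) with u a vertex of I, and
   pi_I is the first projection. *)
Definition solvable (V W : finType)
    (Task : labelled (('I_n.+1 * 'I_n.+1) * W)%type)
    (Prot : labelled (('I_n.+1 * 'I_n.+1) * V)%type) : Prop :=
  exists delta : ('I_n.+1 * 'I_n.+1) * V -> ('I_n.+1 * 'I_n.+1) * W,
    morphism Prot Task delta
    /\ {in vertexes Prot, forall z, (delta z).1 = z.1}.

Section SetAgreement.
Variable k : nat.

Definition decisions : {set {ffun 'I_n.+1 -> 'I_n.+1}} :=
  [set d : {ffun 'I_n.+1 -> 'I_n.+1} | #|[set d a | a : 'I_n.+1]| <= k].

Definition SA : complex ('I_n.+1 * 'I_n.+1)%type := graph_complex decisions.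

Definition valid (X : {set 'I_n.+1 * 'I_n.+1})
    (d : {ffun 'I_n.+1 -> 'I_n.+1}) : bool :=
  [forall a : 'I_n.+1, exists a' : 'I_n.+1, (a', d a) \in X].

Definition set_agreement_facets :
    {set {set ('I_n.+1 * 'I_n.+1) * ('I_n.+1 * 'I_n.+1)}} :=
  [set prod_facet initial SA X (graph d)
     | X in facets initial, d in [set d in decisions | valid X d]].

Fact set_agreement_sub :
  set_agreement_facets \subset facets (prod_complex initial SA).
Proof.
apply/subsetP=> _ /imset2P[X d FX + ->]; rewrite inE => /andP[Dd _].
by rewrite facets_prod; apply: imset2_f; rewrite // facets_graph imset_f.
Qed.

Definition set_agreement_task :
    labelled (('I_n.+1 * 'I_n.+1) * ('I_n.+1 * 'I_n.+1))%type :=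
  Labelled (subcomplex set_agreement_sub) (@product_label _).

End SetAgreement.

Section Adversary.
Variable A : {set {set 'I_n.+1}}.

Definition superset_closed_adversary : Prop :=
  [/\ A != set0, set0 \notin A
    & forall P P' : {set 'I_n.+1}, P \in A -> P \subset P' -> P' \in A].

Definition hitting (C : {set 'I_n.+1}) : bool :=
  [forall P in A, C :&: P != set0].

Definition core (C : {set 'I_n.+1}) : bool := minset hitting C.

(* The default value n.+1 bounds the cardinality of every core, and a core
   exists as soon as set0 \notin A: see [csize_leq] and [csize_attained]. *)
Definition csize : nat := \big[minn/n.+1]_(C : {set 'I_n.+1} | core C) #|C|.

Lemma core_exists : set0 \notin A -> exists C, core C.
Proof.
move=> A0; have hT : hitting setT.
  by apply/forall_inP=> P AP; rewrite setTI; apply: contraNneq A0 => <-.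
by have [C coreC _] := minset_exists hT; exists C.
Qed.

Lemma csize_leq C : core C -> csize <= #|C|.
Proof.
move=> coreC; rewrite /csize; have := mem_index_enum C.
elim: (index_enum _) => // D s IHs; rewrite big_cons inE => /orP[/eqP<-|/IHs].
  by rewrite coreC geq_minl.
by case: ifP => // _; apply: leq_trans; rewrite geq_minr.
Qed.

Lemma csize_attained : set0 \notin A -> exists2 C, core C & #|C| = csize.
Proof.
move=> /core_exists[C0 core0].
have [C coreC minC] := arg_minnP (fun C : {set 'I_n.+1} => #|C|) core0.
exists C => //; apply/eqP; rewrite eqn_leq csize_leq // andbT /csize.
elim/big_ind: _ => [|x y lex ley|D coreD]; last exact: minC.
  by rewrite (leq_trans (max_card _)) ?card_ord.
by rewrite leq_min lex ley.
Qed.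

Definition schedules : {set {ffun 'I_n.+1 -> {set 'I_n.+1}}} :=
  [set S : {ffun 'I_n.+1 -> {set 'I_n.+1}} |
     [forall a, (S a \in A) && (a \in S a)] &&
     [forall a, forall a', (S a \subset S a') || (S a' \subset S a)]].

Definition view (X : {set 'I_n.+1 * 'I_n.+1})
    (S : {ffun 'I_n.+1 -> {set 'I_n.+1}}) :
    {ffun 'I_n.+1 -> {set 'I_n.+1 * 'I_n.+1}} :=
  [ffun a => [set u in X | color initial u \in S a]].

Definition round : complex ('I_n.+1 * {set 'I_n.+1 * 'I_n.+1})%type :=
  graph_complex [set view X S | X in facets initial, S in schedules].

Definition round_facets :
    {set {set ('I_n.+1 * 'I_n.+1) * ('I_n.+1 * {set 'I_n.+1 * 'I_n.+1})}} :=
  [set prod_facet initial round X (graph (view X S))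
     | X in facets initial, S in schedules].

Fact round_sub : round_facets \subset facets (prod_complex initial round).
Proof.
apply/subsetP=> _ /imset2P[X S FX SS ->]; rewrite facets_prod.
by apply: imset2_f; rewrite // facets_graph imset_f // imset2_f.
Qed.

Definition round_protocol :
    labelled (('I_n.+1 * 'I_n.+1)
              * ('I_n.+1 * {set 'I_n.+1 * 'I_n.+1}))%type :=
  Labelled (subcomplex round_sub) (@product_label _).

End Adversary.

End Complexes.

Arguments initial n : clear implicits.
Arguments SA n k : clear implicits.
Arguments set_agreement_task n k : clear implicits.

(* Main.v *)
(* A set of at most [k < csize A] processes is not hitting, so its complement
   lies in [A]: every schedule in which each process misses at most [k] inputs is
   admissible.  Over F_2, the order complex of the partial inputs of size at least
   [n+1-k] with values in a nonempty set [tau] is (k-1)-acyclic, and so is, in the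
   dimensions needed, the complex of views lying between the least and the
   greatest element of a chain of partial inputs.  Composing two acyclic-carrier
   arguments maps each face [tau] of a [k]-simplex of input values to a chain of
   executions whose views only contain values in [tau].  By validity the decision
   map is then a Sperner labelling, so some execution decides [k+1] different
   values. *)

Require Import Defs.
From mathcomp Require Import all_boot all_algebra.

Set Implicit Arguments.
Unset Strict Implicit.
Unset Printing Implicit Defensive.

Import GRing.Theory.

(** * Reduced F_2-homology of clique complexes *)

Section Chains.
Local Open Scope ring_scope.
Variables (V : finType) (adj : rel V).
Hypothesis adjC : symmetric adj.

(** Chains are functions on all subsets of [V]; living on cliques of a given cardinality is imposed
    separately by [supported]. *)
Definition chain := {ffun {set V} -> 'F_2}.
Implicit Types (c y : chain) (s t W : {set V}) (v w : V).

Lemma addF2 (x : 'F_2) : x + x = 0.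
Proof. by rewrite addrr_pchar2 // pchar_Fp. Qed.

Lemma addF2_eq0 (x y : 'F_2) : x + y = 0 -> x = y.
Proof. by move=> /eqP; rewrite addr_eq0 oppr_pchar2 ?pchar_Fp // => /eqP. Qed.

(** The terms at [(i, j)] and [(j, i)] cancel in characteristic 2; [enum_rank] orients each
    unordered pair. *)
Lemma sum_symF2 (T : finType) (P : pred T) (F : T -> T -> 'F_2) :
  (forall i j, F i j = F j i) ->
  \sum_(i | P i) \sum_(j | P j && (j != i)) F i j = 0.
Proof.
move=> symF; pose lt (i j : T) := (enum_rank i < enum_rank j)%N.
rewrite (eq_bigr (fun i => \sum_(j | P j && lt i j) F i j
   + \sum_(j | P j && lt j i) F j i)).
  rewrite big_split /= [X in _ + X](exchange_big_dep P) /=; last by move=> i j _ /andP[].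
  rewrite -big_split /= big1 // => i Pi; by rewrite Pi addF2.
move=> i Pi; rewrite (bigID (lt i)) /=; congr (_ + _).
  apply: eq_bigl => j; rewrite -andbA; congr (_ && _).
  by rewrite /lt; case: eqP => [->|] //; rewrite ltnn.
rewrite (eq_bigr _ (fun j _ => symF i j)); apply: eq_bigl => j.
rewrite -andbA; congr (_ && _); rewrite /lt -leqNgt ltn_neqAle.
by rewrite (inj_eq val_inj) (inj_eq enum_rank_inj).
Qed.

(* The boundary with the empty simplex in degree -1, so that cycles are cycles
   of reduced homology. *)
Definition bd c : chain := [ffun s : {set V} => \sum_(v | v \notin s) c (v |: s)].

Lemma bdD c y : bd (c + y) = bd c + bd y.
Proof.
apply/ffunP=> s; rewrite !ffunE -big_split /=.
by apply: eq_bigr => v _; rewrite ffunE.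
Qed.

Lemma bd_sum (I : finType) (P : pred I) (F : I -> chain) :
  bd (\sum_(i | P i) F i) = \sum_(i | P i) bd (F i).
Proof.
apply: (big_morph bd bdD); apply/ffunP=> s; rewrite !ffunE big1 // => v _.
by rewrite ffunE.
Qed.

Definition clique s := [forall v in s, forall w in s, (v != w) ==> adj v w].

Lemma cliqueP s :
  reflect (forall v w, v \in s -> w \in s -> v != w -> adj v w) (clique s).
Proof.
apply: (iffP forall_inP) => [h v w vs ws|h v vs].
  by move/implyP: (forall_inP (h v vs) w ws).
by apply/forall_inP=> w ws; apply/implyP; apply: h.
Qed.

Lemma clique_sub s t : s \subset t -> clique t -> clique s.
Proof.
move=> /subsetP st /cliqueP h; apply/cliqueP=> v w /st vt /st wt; exact: h.
Qed.

Definition simplex (W : {set V}) j s := [&& s \subset W, clique s & #|s| == j].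

Definition supported W j c := [forall s : {set V}, (c s != 0) ==> simplex W j s].

Lemma supportedP W j c :
  reflect (forall s, c s != 0 -> simplex W j s) (supported W j c).
Proof. by apply: (iffP forallP) => h s; apply/implyP; apply: h. Qed.

Lemma supportedD W j c y :
  supported W j c -> supported W j y -> supported W j (c + y).
Proof.
move=> /supportedP hc /supportedP hy; apply/supportedP=> s; rewrite ffunE.
by have [->|/hc //] := eqVneq (c s) 0; rewrite add0r => /hy.
Qed.

Lemma supported_sum W j (I : finType) (P : pred I) (F : I -> chain) :
  (forall i, P i -> supported W j (F i)) ->
  supported W j (\sum_(i | P i) F i).
Proof.
move=> h; apply: (big_ind (supported W j)) => // [|c y]; last exact: supportedD.
by apply/supportedP=> s; rewrite ffunE eqxx.
Qed.

Lemma supported_sub W (W' : {set V}) j c :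
  W \subset W' -> supported W j c -> supported W' j c.
Proof.
move=> sW /supportedP h; apply/supportedP=> s /h /and3P[sW0 cl cs].
by rewrite /simplex cl cs (subset_trans sW0).
Qed.

(* Degrees are cardinalities: [acyclic d] is (d-2)-acyclicity. *)
Definition acyclic d (W : {set V}) := forall j c,
  (j < d)%N -> supported W j c -> bd c = 0 ->
  exists2 y, supported W j.+1 y & bd y = c.

Lemma acyclic_le d d' W : (d <= d')%N -> acyclic d' W -> acyclic d W.
Proof. by move=> le_d h j c jd; apply: h; apply: leq_trans le_d. Qed.

(** * Cones, antistars and links of chains *)

Definition cone w c : chain := [ffun s : {set V} => if w \in s then c (s :\ w) else 0].

Definition antistar w c : chain := [ffun s : {set V} => if w \in s then 0 else c s].

Definition link w c : chain := [ffun s : {set V} => if w \in s then 0 else c (w |: s)].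

Lemma cone_decomp w c : c = antistar w c + cone w (link w c).
Proof.
apply/ffunP=> s; rewrite !ffunE; case: ifP => ws; rewrite ?addr0 //.
by rewrite in_setD1 eqxx /= setD1K // add0r.
Qed.

(** Dropping [w] from a simplex of the cone gives back [c]; dropping any other vertex gives a
    simplex of the cone over [bd c]. *)
Lemma bd_cone w c : (forall s, w \in s -> c s = 0) ->
  bd (cone w c) = c + cone w (bd c).
Proof.
move=> c0; apply/ffunP=> s; rewrite !ffunE; case: ifP => ws.
  rewrite c0 // add0r [in RHS](bigD1 w) /= ?in_setD1 ?eqxx //.
  rewrite setD1K // c0 // add0r; apply: eq_big => v.
    rewrite in_setD1 negb_and negbK andb_orl.
    by case: (eqVneq v w) => [->|]; rewrite ?ws //= ?andbF ?andbT //.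
  move=> vs; rewrite ffunE in_setU1 ws orbT; congr (c _).
  apply/setP=> x; rewrite !inE; case: (eqVneq x v) => [->|] //=.
  by case: eqP vs => // ->; rewrite ws.
rewrite addr0 (bigD1 w) ?ws //= ffunE setU11 setU1K ?ws // big1 ?addr0 //.
by move=> v /andP[_ vw]; rewrite ffunE in_setU1 eq_sym (negPf vw) ws.
Qed.

(** For [s] avoiding [w], split [bd c s = 0] into the coface [w |: s] and the cofaces that avoid
    [w]. *)
Lemma cycle_antistar w c : bd c = 0 -> bd (antistar w c) = link w c.
Proof.
move=> /ffunP c0; apply/ffunP=> s; rewrite !ffunE; case: ifP => ws.
  by rewrite big1 // => v _; rewrite ffunE in_setU1 ws orbT.
have := c0 s; rewrite !ffunE (bigD1 w) /= ?ws // => /addF2_eq0 ->.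
rewrite (bigD1 w) ?ws //= ffunE setU11 add0r; apply: eq_bigr => v /andP[_ vw].
by rewrite ffunE in_setU1 eq_sym (negPf vw) ws.
Qed.

Lemma bd_link w c : bd c = 0 -> bd (link w c) = 0.
Proof.
move=> /ffunP c0; apply/ffunP=> s; rewrite !ffunE.
have [ws|ws] := boolP (w \in s).
  by rewrite big1 // => v _; rewrite ffunE in_setU1 ws orbT.
have := c0 (w |: s); rewrite !ffunE => c0ws; apply: etrans c0ws.
rewrite (bigD1 w) //= ffunE setU11 add0r; apply: eq_big => v.
  by rewrite in_setU1 negb_or andbC.
move=> /andP[_ vw]; rewrite ffunE in_setU1 eq_sym (negPf vw) (negPf ws) /=.
by rewrite setUCA.
Qed.

Definition nbrs w : {set V} := [set v | (v != w) && adj w v].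

Lemma antistar_supported W j w c :
  supported W j c -> supported (W :\ w) j (antistar w c).
Proof.
move=> /supportedP h; apply/supportedP=> s; rewrite ffunE.
case: ifP => [|ws /h]; first by rewrite eqxx.
by rewrite /simplex subsetD1 ws => /and3P[-> -> ->].
Qed.

Lemma link_supported W j w c :
  supported W j.+1 c -> supported (W :&: nbrs w) j (link w c).
Proof.
move=> /supportedP h; apply/supportedP=> s; rewrite ffunE.
case: ifP => [|ws /h]; first by rewrite eqxx.
case/and3P; rewrite subUset => /andP[_ sW] cl.
rewrite cardsU1 ws => cs; rewrite /simplex (clique_sub (subsetU1 w s) cl).
rewrite -eqSS cs !andbT subsetI sW; apply/subsetP=> v vs.
have vw: v != w by apply: contraFneq ws => <-.
rewrite inE vw; move/cliqueP: cl; apply; rewrite ?setU11 1?eq_sym //.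
by rewrite in_setU1 vs orbT.
Qed.

Lemma cone_supported W j w c : w \in W ->
  supported (W :&: nbrs w) j c -> supported W j.+1 (cone w c).
Proof.
move=> wW /supportedP h; apply/supportedP=> s; rewrite ffunE.
case: ifP => [ws /h|]; last by rewrite eqxx.
case/and3P; rewrite subsetI => /andP[sW sN] /cliqueP cl cs.
apply/and3P; split.
- by rewrite -(setD1K ws) subUset sub1set wW.
- have aw x : x \in s -> x != w -> adj w x.
    move=> xs xw; have /(subsetP sN) : x \in s :\ w by rewrite in_setD1 xw.
    by rewrite inE => /andP[].
  apply/cliqueP=> v u vs us vu.
  have [vw|vw] := eqVneq v w; first by rewrite vw aw // -vw eq_sym.
  have [uw|uw] := eqVneq u w; first by rewrite adjC uw aw.
  by apply: cl; rewrite // in_setD1 ?vw ?uw.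
- by rewrite (cardsD1 w) ws add1n eqSS.
Qed.

(** The cone over [antistar t c] has boundary [antistar t c + cone t (link t c)], which is the cycle
    [c] itself. *)
Lemma acyclic_cone (t : V) W d :
  t \in W -> {in W, forall v, v != t -> adj t v} -> acyclic d W.
Proof.
move=> tW tadj j c _ sc c0; exists (cone t (antistar t c)).
  apply: cone_supported => //.
  apply: supported_sub (antistar_supported t sc); apply/subsetP=> v.
  by rewrite !inE => /andP[vt vW]; rewrite vW vt tadj.
rewrite bd_cone ?cycle_antistar -?cone_decomp // => s ts.
by rewrite ffunE ts.
Qed.

(* Mayer-Vietoris for the star of [w]. *)
Lemma acyclic_remove d W w : w \in W -> acyclic d.+1 (W :\ w) ->
  acyclic d (W :&: nbrs w) -> acyclic d.+1 W.
Proof.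
move=> wW aW aN [|j] c jd sc c0.
  (* Here only the empty simplex can occur, so [c] is already supported on [W :\ w]. *)
  have [|y sy <-] := aW 0%N c jd _ c0.
    apply/supportedP=> s /(supportedP _ _ _ sc) /and3P[_ cl cs].
    by rewrite /simplex cl cs andbT; move: cs; rewrite cards_eq0 => /eqP ->; rewrite sub0set.
  by exists y => //; apply: supported_sub sy; apply: subD1set.
(* With [e] filling the link, [antistar w c + e] is a cycle avoiding [w]; if [y] fills it, then
   [y + cone w e] fills [c]. *)
have [e se be] := aN j _ jd (link_supported w sc) (bd_link w c0).
have e0 s : w \in s -> e s = 0.
  move=> ws; apply/eqP; apply: contraTT ws => /(supportedP _ _ _ se) /and3P[sW _ _].
  apply/negP=> /(subsetP sW); by rewrite !inE eqxx andbF.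
have bce := bd_cone e0; rewrite be in bce.
have [| |y sy by_] := aW j.+1 (antistar w c + e) jd.
- apply: supportedD (antistar_supported w sc) _.
  apply: supported_sub se; apply/subsetP=> v; rewrite !inE.
  by case/and3P=> -> ->.
- rewrite bdD be cycle_antistar //; apply/ffunP=> s; rewrite !ffunE.
  by case: ifP; rewrite ?addr0 ?addF2.
exists (y + cone w e).
  apply: supportedD; last exact: cone_supported.
  by apply: supported_sub sy; apply: subD1set.
rewrite bdD by_ bce [in RHS](cone_decomp w c) addrA -[_ + e + e]addrA.
suff -> : e + e = 0 by rewrite addr0.
by apply/ffunP=> s; rewrite !ffunE addF2.
Qed.

(** Vertexes are added to [W0] by increasing [rho]. Since ties are not adjacent, each new vertex is
    glued along its lower link only, and [acyclic_remove] applies to the last one. *)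
Lemma acyclic_build d (rho : V -> nat) (W0 W : {set V}) : W0 \subset W ->
  acyclic d.+1 W0 ->
  {in W :\: W0 &, forall v w, rho v = rho w -> v != w -> ~~ adj v w} ->
  {in W :\: W0, forall w, acyclic d
     [set v in W | [&& v != w, adj w v & (v \in W0) || (rho v < rho w)%N]]} ->
  acyclic d.+1 W.
Proof.
move=> sW0 aW0; have [m] := ubnP #|W :\: W0|.
elim: m => // m IHm in W sW0 * => leW ties aL.
have [/eqP|/set0Pn[w0 w0D]] := eqVneq (W :\: W0) set0.
  rewrite setD_eq0 => sW; suff -> : W = W0 by [].
  by apply/eqP; rewrite eqEsubset sW.
have [w wD maxw] := @arg_maxnP _ w0 (fun v => v \in W :\: W0) rho w0D.
have wW : w \in W by case/setDP: wD.
have w0F : w \notin W0 by case/setDP: wD.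
have DD : W :\ w :\: W0 = (W :\: W0) :\ w.
  by rewrite setDDl setUC -setDDl.
apply: (@acyclic_remove _ _ w) => //.
  apply: IHm.
  - by rewrite subsetD1 sW0.
  - by rewrite DD -ltnS (leq_trans _ leW) // ltnS [X in (_ < X)%N](cardsD1 w) wD.
  - by move=> u v; rewrite DD => /setD1P[_ uD] /setD1P[_ vD]; apply: ties.
  (* As [rho w] is maximal, [w] lies in no lower link, so removing it changes none of them. *)
  move=> u; rewrite DD => /setD1P[uw uD].
  suff -> : [set v in W :\ w | [&& v != u, adj u v & (v \in W0) || (rho v < rho u)%N]]
    = [set v in W | [&& v != u, adj u v & (v \in W0) || (rho v < rho u)%N]].
    exact: aL.
  apply/setP=> v; rewrite !inE; case: (eqVneq v w) => //= ->.
  have /= le_uw := maxw u uD.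
  by rewrite (negPf w0F) ltnNge le_uw /= !andbF.
suff -> : W :&: nbrs w = [set v in W | [&& v != w, adj w v & (v \in W0) || (rho v < rho w)%N]].
  exact: aL.
apply/setP=> v; rewrite !inE; case vW: (v \in W) => //=; case vw: (v == w) => //=.
case a: (adj w v) => //=; case v0: (v \in W0) => //=.
have vD : v \in W :\: W0 by rewrite inE v0.
have /= le_vw := maxw v vD.
rewrite ltn_neqAle le_vw andbT; apply/esym/eqP=> e.
by have := ties v w vD wD e; rewrite vw adjC a => /(_ isT).
Qed.

End Chains.

(** * Acyclic carriers and Sperner's lemma *)

Section Carriers.
Local Open Scope ring_scope.

(** Boundary and coboundary are adjoint: both sides sum over pairs [v \in s], with [r = s :\ v]. *)
Lemma sum_bd (V : finType) (c : chain V) (g : {set V} -> 'F_2) :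
  \sum_r bd c r * g r = \sum_s c s * \sum_(v in s) g (s :\ v).
Proof.
rewrite (eq_bigr (fun r : {set V} => \sum_(v | v \notin r) c (v |: r) * g r));
  last by move=> r _; rewrite ffunE big_distrl.
rewrite [RHS](eq_bigr (fun s : {set V} => \sum_(v in s) c s * g (s :\ v)));
  last by move=> s _; rewrite big_distrr.
rewrite (exchange_big_dep predT) //= [RHS](exchange_big_dep predT) //=.
apply: eq_bigr => v _.
rewrite (reindex_onto (fun s => s :\ v) (fun r => v |: r)) /=; last first.
  by move=> r vr; rewrite setU1K.
apply: eq_big => s; last by case/andP=> _ /eqP ->.
rewrite in_setD1 eqxx /=; apply/eqP/idP => [<-|]; first exact: setU11.
exact: setD1K.
Qed.

(** The generator of reduced degree -1; sending [set0] to it is what preserves the augmentation. *)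
Definition unit_chain (V : finType) : chain V := [ffun s => (s == set0)%:R].

Lemma unit_chain_supported (V : finType) (adj : rel V) (W : {set V}) :
  supported adj W 0 (unit_chain V).
Proof.
apply/supportedP=> s; rewrite ffunE; case: (eqVneq s set0) => [-> _|]; last by rewrite eqxx.
rewrite /simplex sub0set cards0 eqxx andbT /=; apply/cliqueP=> v w.
by rewrite inE.
Qed.

(* [phi] is an augmentation-preserving chain map subordinate to [car]. *)
Definition carried (X V : finType) (adj : rel V) (good : pred {set X})
    (car : {set X} -> {set V}) (phi : {set X} -> chain V) :=
  phi set0 = unit_chain V /\ forall s, good s ->
    supported adj (car s) #|s| (phi s)
    /\ bd (phi s) = \sum_(x in s) phi (s :\ x).

(** Induction on the cardinality of [s]: the values already chosen on the faces of [s] add up to a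
    cycle in [car s], and acyclicity supplies a filling. *)
Lemma acyclic_carrier (X V : finType) (adj : rel V) (good : pred {set X})
    (car : {set X} -> {set V}) :
  (forall s t : {set X}, good t -> s \subset t -> good s) ->
  (forall s t : {set X}, s \subset t -> car s \subset car t) ->
  (forall s, good s -> s != set0 -> acyclic adj #|s| (car s)) ->
  exists phi, carried adj good car phi.
Proof.
move=> good_sub car_sub acar.
pose ok (phi : {set X} -> chain V) (s : {set X}) :=
  supported adj (car s) #|s| (phi s) /\ bd (phi s) = \sum_(x in s) phi (s :\ x).
suff [phi [phi0 phiP]] : exists phi, phi set0 = unit_chain V /\
    forall s, good s -> (#|s| <= #|X|)%N -> ok phi s.
  by exists phi; split=> // s gs; apply: phiP; rewrite ?max_card.
elim: #|X| => [|m [phi [phi0 phiP]]].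
  exists (fun=> unit_chain V); split=> // s _.
  rewrite leqn0 cards_eq0 => /eqP ->; split.
    by rewrite cards0; apply: unit_chain_supported.
  rewrite big_set0; apply/ffunP=> s'; rewrite !ffunE big1 // => v vs.
  by rewrite ffunE -cards_eq0 cardsU1 vs.
have : forall s : {set X}, exists y, good s && (#|s| == m.+1) ->
    supported adj (car s) #|s| y /\ bd y = \sum_(x in s) phi (s :\ x).
  move=> s; have [/andP[gs /eqP sm]|_] := boolP (_ && _); last by exists 0.
  have s0 : s != set0 by rewrite -card_gt0 sm.
  have okD x : x \in s -> ok phi (s :\ x).
    move=> xs; apply: phiP; first exact: good_sub gs (subsetDl _ _).
    by rewrite -ltnS -sm (cardsD1 x s) xs.
  have [| | |y sy by_] := acar s gs s0 m (\sum_(x in s) phi (s :\ x)).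
  - by rewrite sm.
  - apply: supported_sum => x xs; have [+ _] := okD x xs.
    have -> : #|s :\ x| = m by apply/eqP; rewrite -eqSS -sm (cardsD1 x s) xs.
    by apply: supported_sub; apply: car_sub; apply: subD1set.
  (* Deleting [x] then [y], or [y] then [x], leaves the same face, so the double sum cancels in
     pairs. *)
  - rewrite bd_sum (eq_bigr (fun x => \sum_(y | (y \in s) && (y != x)) phi (s :\ x :\ y))).
      apply/ffunP=> t; rewrite sum_ffunE ffunE.
      under eq_bigr do rewrite sum_ffunE.
      by apply: sum_symF2 => x y; rewrite setDDl setUC -setDDl.
    move=> x xs; rewrite (okD x xs).2; apply: eq_bigl => y.
    by rewrite in_setD1 andbC.
  by exists y => _; rewrite sm.
case/fin_all_exists => y yP.
pose psi s := if good s && (#|s| == m.+1) then y s else phi s.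
exists psi; split; first by rewrite /psi cards0 andbF.
have psiD (s : {set X}) x : #|s| = m.+1 -> x \in s -> psi (s :\ x) = phi (s :\ x).
  move=> sm xs; rewrite /psi; case: ifP => // /andP[_ /eqP cD].
  by move: sm; rewrite (cardsD1 x s) xs cD add1n => -[/esym/n_Sn].
move=> s gs; rewrite leq_eqVlt ltnS => /orP[/eqP sm|sm].
  have := yP s; rewrite /ok {1 2}/psi gs sm eqxx => /(_ isT)[sy ->].
  by split=> //; apply: eq_bigr => x xs; rewrite psiD.
have psiE (t : {set X}) : (#|t| <= m)%N -> psi t = phi t.
  by rewrite /psi; case: ifP => // /andP[_ /eqP ->]; rewrite ltnn.
have [ss sb] := phiP s gs sm; split; rewrite psiE // sb.
by apply: eq_bigr => x xs; rewrite psiE // (leq_trans _ sm) // subset_leq_card ?subD1set.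
Qed.

Definition push (X V : finType) (phi : {set X} -> chain V) (c : chain X) :
  chain V := [ffun x => \sum_s c s * phi s x].

(** By [sum_bd], the linear extension [push psi] commutes with the boundary on chains of good
    simplexes; the last hypothesis compares the carriers. *)
Lemma carried_comp (L X V : finType) (adjX : rel X) (adjV : rel V)
    (goodL : pred {set L}) (goodX : pred {set X})
    (carL : {set L} -> {set X}) (carX : {set X} -> {set V})
    (car : {set L} -> {set V}) phi psi :
  carried adjX goodL carL phi -> carried adjV goodX carX psi ->
  (forall tau s, goodL tau -> simplex adjX (carL tau) #|tau| s ->
    goodX s /\ carX s \subset car tau) ->
  carried adjV goodL car (fun tau => push psi (phi tau)).
Proof.
move=> [phi0 phiP] [psi0 psiP] h; split.
  apply/ffunP=> x; rewrite ffunE (bigD1 set0) //= big1 ?addr0.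
    by rewrite phi0 psi0 !ffunE eqxx mul1r.
  by move=> s s0; rewrite phi0 ffunE (negPf s0) mul0r.
move=> tau gtau; have [/supportedP stau btau] := phiP tau gtau.
have hs s : phi tau s != 0 -> [/\ goodX s, carX s \subset car tau & #|s| = #|tau|].
  by move=> /stau sims; have [? ?] := h _ _ gtau sims; case/and3P: sims => _ _ /eqP.
split.
  apply/supportedP=> x; apply: contraNT => nx; rewrite ffunE big1 // => s _.
  have [->|/hs[gs ss cs]] := eqVneq (phi tau s) 0; first by rewrite mul0r.
  have [/(supported_sub ss) + _] := psiP s gs; rewrite cs => /supportedP sp.
  by rewrite [psi s x](_ : _ = 0) ?mulr0 //; apply/eqP; apply: contraNT nx; apply: sp.
transitivity (push psi (bd (phi tau))); last first.
  rewrite btau; apply/ffunP=> x; rewrite ffunE sum_ffunE.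
  under [RHS]eq_bigr do rewrite ffunE.
  rewrite [RHS]exchange_big /=; apply: eq_bigr => s _.
  by rewrite sum_ffunE big_distrl.
apply/ffunP=> x; rewrite !ffunE sum_bd.
under eq_bigr do rewrite ffunE.
rewrite exchange_big /=; apply: eq_bigr => s _; rewrite -big_distrr /=.
have [->|/hs[gs _ _]] := eqVneq (phi tau s) 0; first by rewrite !mul0r.
have [_ /ffunP/(_ x)] := psiP s gs; rewrite ffunE => ->.
by rewrite sum_ffunE.
Qed.

(** * Sperner labellings *)

Definition rainbow (V L : finType) (f : V -> L) (tau : {set L}) (c : chain V) :=
  \sum_s c s * (f @: s == tau)%:R.

(** Door counting, one simplex [s] at a time: if [f @: s = tau], exactly one face has label set
    [tau :\ i]; otherwise there are none or exactly two. *)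
Lemma rainbow_bd (V L : finType) (adj : rel V) (W : {set V}) (f : V -> L)
    (tau : {set L}) i c :
  i \in tau -> supported adj W #|tau| c -> {in W, forall v, f v \in tau} ->
  rainbow f (tau :\ i) (bd c) = rainbow f tau c.
Proof.
move=> itau /supportedP sc fW; rewrite /rainbow sum_bd; apply: eq_bigr => s _.
have [->|/sc/and3P[sW _ /eqP cs]] := eqVneq (c s) 0; first by rewrite !mul0r.
congr (_ * _); have [fs|fs] := eqVneq (f @: s) tau.
  have injf : {in s &, injective f} by apply/imset_injP; rewrite fs cs.
  have /imsetP[v0 v0s iv0] : i \in f @: s by rewrite fs.
  have fsD v : v \in s -> f @: (s :\ v) = tau :\ f v.
    move=> vs; rewrite -fs; apply/setP=> x; apply/imsetP/setD1P.
      case=> w /setD1P[wv ws] ->; split; last exact: imset_f.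
      by apply: contraNneq wv => /injf ->.
    case=> xv /imsetP[w ws xw]; exists w => //; rewrite in_setD1 ws andbT.
    by apply: contraNneq xv => wv; rewrite xw wv.
  rewrite (bigD1 v0) //= fsD // -iv0 eqxx big1 ?addr0 // => v /andP[vs vv0].
  rewrite fsD //; case: eqP => // /setP/(_ i).
  rewrite !in_setD1 eqxx itau andbT /= => /negbFE/eqP ifv.
  by case/eqP: vv0; apply: injf; rewrite // -ifv.
have [/exists_inP[v vs /eqP fsv]|none] := boolP [exists v in s, f @: (s :\ v) == tau :\ i];
  last first.
  rewrite big1 // => v vs; case: eqP => // fsv; case/negP: none.
  by apply/exists_inP; exists v => //; apply/eqP.
have fsU : f @: s = f v |: f @: (s :\ v) by rewrite -imsetU1 setD1K.
have fvi : f v != i.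
  by apply: contraNneq fs => fvi; rewrite fsU fsv fvi setD1K.
(* The label of [v] survives its deletion, hence is shared by some [w]; deleting [v] or [w] gives
   the two faces counted. *)
have /imsetP[w /setD1P[wv ws] fvw] : f v \in f @: (s :\ v).
  by rewrite fsv in_setD1 fvi fW // (subsetP sW).
have fsw : f @: (s :\ w) = tau :\ i.
  rewrite -fsv; apply/setP=> x; apply/imsetP/imsetP=> -[u /setD1P[uw us] ->].
    have [->|uv] := eqVneq u v; last by exists u; rewrite // in_setD1 uv.
    by exists w; rewrite // in_setD1 wv.
  have [->|uv] := eqVneq u w; last by exists u; rewrite // in_setD1 uv.
  by exists v; rewrite // in_setD1 eq_sym wv.
rewrite (bigD1 v) //= (bigD1 w) /= ?ws // fsv fsw eqxx big1 ?addr0 ?addF2 // => u.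
case/andP=> /andP[us uv] uw; case: eqP => // fsu; exfalso.
(* A third such face would contain both [v] and [w], and their common label leaves it too few
   labels. *)
have : (#|f @: (s :\ u)| <= #|s :\ u :\ v|)%N.
  apply: leq_trans (leq_imset_card f _); apply/subset_leq_card/subsetP=> x.
  case/imsetP=> y /setD1P[yu ys] ->; have [->|yv] := eqVneq y v.
    by rewrite fvw; apply: imset_f; rewrite !in_setD1 wv ws eq_sym uw.
  by apply: imset_f; rewrite !in_setD1 yv yu.
rewrite fsu; have := cardsD1 i tau; have := cardsD1 u s; have := cardsD1 v (s :\ u).
by rewrite in_setD1 us vs itau eq_sym uv -cs /= => -> ->; rewrite !add1n => -[<-]; rewrite ltnn.
Qed.

(** The parity of rainbow simplexes of [phi tau] is 1, by induction on [tau]: pass to the boundary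
    and keep the summand [phi (tau :\ i)]. *)
Lemma sperner (V L : finType) (adj : rel V) (good : pred {set L})
    (car : {set L} -> {set V}) (f : V -> L) phi tau :
  (forall s t : {set L}, good t -> s \subset t -> good s) ->
  (forall t v, good t -> v \in car t -> f v \in t) ->
  carried adj good car phi -> good tau ->
  exists2 s, simplex adj (car tau) #|tau| s & f @: s = tau.
Proof.
move=> good_sub fcar [phi0 phiP] gtau.
have rb1 : rainbow f tau (phi tau) = 1.
  have [m] := ubnP #|tau|; elim: m => // m IHm in tau gtau * => ltm.
  have [->|/set0Pn[i itau]] := eqVneq tau set0.
    rewrite phi0 /rainbow (bigD1 set0) //= ffunE imset0 !eqxx mulr1 big1 ?addr0 // => s s0.
    by rewrite ffunE (negPf s0) mul0r.
  have [stau btau] := phiP tau gtau.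
  have gD x : good (tau :\ x) by apply: good_sub gtau (subD1set _ _).
  rewrite -(rainbow_bd itau stau); last by move=> v; apply: fcar.
  rewrite btau /rainbow; under eq_bigr do rewrite sum_ffunE big_distrl.
  rewrite exchange_big (bigD1 i) //= [X in _ + X]big1 ?addr0.
    apply: IHm => //; rewrite -ltnS; apply: leq_trans ltm.
    by rewrite ltnS [X in (_ < X)%N](cardsD1 i) itau.
  (* Labels on [car (tau :\ x)] avoid [x], whereas [tau :\ i] contains it. *)
  move=> x /andP[xtau xi]; rewrite big1 // => s _.
  have [/supportedP sx _] := phiP _ (gD x).
  have [->|/sx/and3P[sW _ _]] := eqVneq (phi (tau :\ x) s) 0; first by rewrite mul0r.
  case: eqP => [fs|]; last by rewrite mulr0.
  have /imsetP[v vs xv] : x \in f @: s by rewrite fs in_setD1 xi.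
  by have := fcar _ v (gD x) (subsetP sW v vs); rewrite -xv in_setD1 eqxx.
have [/exists_inP[s sims /eqP fs]|none] :=
    boolP [exists s in simplex adj (car tau) #|tau|, f @: s == tau].
  by exists s.
have [/supportedP stau _] := phiP tau gtau.
case/eqP: (oner_neq0 'F_2); rewrite -rb1 /rainbow big1 // => s _.
have [->|/stau sims] := eqVneq (phi tau s) 0; first by rewrite mul0r.
case: eqP => [fs|]; last by rewrite mulr0.
by case/negP: none; apply/exists_inP; exists s => //; apply/eqP.
Qed.

End Carriers.

(** * Partial inputs and views *)

Section PartialFunctions.

Definition nested (T : finType) (u v : {set T}) :=
  (u \subset v) || (v \subset u).

Lemma nested_sym (T : finType) : symmetric (@nested T).
Proof. by move=> u v; rewrite /nested orbC. Qed.

Lemma nested_card_inj (T : finType) (u v : {set T}) :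
  nested u v -> #|u| = #|v| -> u = v.
Proof.
by case/orP=> uv cuv; [|apply/esym]; apply/eqP; rewrite eqEcard uv cuv leqnn.
Qed.

(** Fix [d] in [D] outside [L]. The sets avoiding [d] form a cone with apex [G :\ d]; those
    containing [d] are added by decreasing size. *)
Lemma acyclic_interval (T : finType) (k : nat) (L G D : {set T}) :
  L \subset G -> D \subset G -> ~~ (D \subset L) ->
  acyclic (@nested T) k
    [set u : {set T} | [&& L \subset u, u \subset G, #|G :\: u| <= k
                         & ~~ (D \subset u)]].
Proof.
elim: k L => [//|k IHk] L LG DG /subsetPn[d dD dL].
have dG := subsetP DG d dD.
set W := [set u | _]; pose W0 := [set u in W | d \notin u].
have card_lt (u v : {set T}) : v \subset G -> u \subset v -> v != u ->
    #|G :\: v| < #|G :\: u|.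
  move=> vG uv vu; apply: proper_card; rewrite properE setDS //=.
  apply: contra vu => sD; rewrite eqEsubset uv andbT.
  apply/subsetP=> x xv; apply: contraTT (xv) => xu.
  have /(subsetP sD) : x \in G :\: u by rewrite inE xu (subsetP vG).
  by case/setDP.
have W0P u : (u \in W0) = [&& L \subset u, u \subset G, #|G :\: u| <= k.+1 & d \notin u].
  rewrite !inE -!andbA; do 3!congr andb.
  by case du: (d \in u) => /=; rewrite ?andbF ?andbT //; apply/subsetPn; exists d; rewrite ?du.
apply: (@acyclic_build _ _ (@nested_sym T) _ (fun u => #|G :\: u|) W0).
- by apply/subsetP=> u; rewrite inE => /andP[].
- apply: (@acyclic_cone _ _ (@nested_sym T) (G :\ d)).
    rewrite W0P subsetD1 LG dL subsetDl in_setD1 eqxx andbT /=.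
    suff -> : G :\: (G :\ d) = [set d] by rewrite cards1.
    by apply/setP=> x; rewrite !inE; case: eqVneq => [->|] //=; rewrite ?dG ?andNb.
  move=> u; rewrite W0P => /and4P[_ uG _ du] _.
  by rewrite /nested subsetD1 uG du orbT.
- move=> u v /setDP[uW _] /setDP[vW _] cuv; apply: contraNN => /orP[] sub.
    apply: contra_eqT (cuv) => uv; rewrite neq_ltn (card_lt u v) ?orbT //.
      by move: vW; rewrite inE => /and4P[].
    by rewrite eq_sym.
  apply: contra_eqT (cuv) => uv; rewrite neq_ltn (card_lt v u) //.
  by move: uW; rewrite inE => /and4P[].
move=> u /setDP[uW uW0]; have du : d \in u by move: uW0; rewrite inE uW negbK.
move: (uW); rewrite inE => /and4P[Lu uG]; rewrite leq_eqVlt ltnS => /orP[/eqP cu|cu] Du.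
  (* At the smallest admissible size nothing lies below [u], so its lower link is the same kind of
     interval starting at [u], with [k] one less. *)
  apply: (@eq_ind _ _ (acyclic _ k) (IHk u uG DG Du)).
  apply/setP=> v; rewrite !inE; apply/idP/idP.
    case/and4P=> uv vG cv Dv.
    have vu : v != u by apply: contraTneq cv => ->; rewrite cu ltnn.
    by rewrite vG Dv (leqW cv) (subset_trans Lu uv) vu /nested uv /= cu ltnS cv orbT.
  case/and4P=> /and4P[Lv vG _ Dv] vu /orP[uv _|vu'].
    by rewrite uv vG Dv -ltnS -cu card_lt.
  have lt_uv : #|G :\: u| < #|G :\: v| by apply: card_lt; rewrite // eq_sym.
  by rewrite Lv vG Dv ltnNge (ltnW lt_uv) orbF /= leqNgt -cu lt_uv.
(* Otherwise [u :\ d] is still admissible: it lies below every larger set and above every subset of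
   [u] avoiding [d]. *)
apply: (@acyclic_cone _ _ (@nested_sym T) (u :\ d)).
  have uW0' : u :\ d \in W0.
    rewrite W0P subsetD1 Lu dL (subset_trans (subD1set _ _) uG) in_setD1 eqxx /= andbT.
    apply: leq_trans (_ : #|d |: G :\: u| <= _).
      apply/subset_leq_card/subsetP=> x; rewrite !inE negb_and negbK.
      by case: eqVneq.
    by rewrite cardsU1 inE du.
  rewrite inE uW0' /nested subD1set orbT andbT.
  have -> /= : u :\ d \in W by move: uW0'; rewrite inE => /andP[].
  by apply/eqP=> /setP/(_ d); rewrite in_setD1 eqxx du.
move=> v; rewrite inE => /and4P[vW vu cuv]; rewrite inE vW /=.
move=> h _; rewrite /nested; case/orP: cuv => [uv|vu'].
  by rewrite (subset_trans (subD1set _ _) uv).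
case/orP: h => [dv|]; first by rewrite subsetD1 vu' dv orbT.
by rewrite ltnNge subset_leq_card // setDS.
Qed.

(** * Partial inputs *)

Variables I J : finType.
Implicit Types (u v w t : {set I * J}) (tau : {set J}) (k : nat).

Definition dom u : {set I} := fst @: u.

Definition partial_fun u := [forall p in u, forall q in u, (p.1 == q.1) ==> (p == q)].

Lemma partial_funP u : reflect {in u &, injective fst} (partial_fun u).
Proof.
apply: (iffP forall_inP) => [h p q pu qu pq|h p pu].
  by apply/eqP; apply: (implyP (forall_inP (h p pu) q qu)); rewrite pq.
by apply/forall_inP=> q qu; apply/implyP=> /eqP pq; apply/eqP; apply: h.
Qed.

Lemma card_dom u : partial_fun u -> #|dom u| = #|u|.
Proof. by move/partial_funP=> h; rewrite card_in_imset. Qed.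

Lemma partial_fun_sub u v : u \subset v -> partial_fun v -> partial_fun u.
Proof. by move=> /subsetP uv /partial_funP h; apply/partial_funP=> p q /uv pv /uv; apply: h. Qed.

Definition inputs k tau : {set {set I * J}} :=
  [set u | [&& partial_fun u, snd @: u \subset tau & #|I| <= #|u| + k]].

Lemma inputs_between k tau u v w : u \in inputs k tau -> w \in inputs k tau ->
  u \subset v -> v \subset w -> v \in inputs k tau.
Proof.
rewrite !inE => /and3P[_ _ cu] /and3P[pw tw _] uv vw.
rewrite (partial_fun_sub vw pw) (subset_trans (imsetS _ vw) tw) /=.
by rewrite (leq_trans cu) // leq_add2r subset_leq_card.
Qed.

Lemma card_partial_fun u : partial_fun u -> #|u| <= #|I|.
Proof. by move=> pu; rewrite -(card_dom pu) max_card. Qed.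

(* The complex of partial inputs is built from the cone of those taking only
   the value [x]; the others are added by increasing number of values different
   from [x], then by decreasing size. *)
Lemma acyclic_inputs k tau : tau != set0 ->
  acyclic (@nested _) k.+1 (inputs k tau).
Proof.
case/set0Pn=> x xtau; pose D u := [set p in u | p.2 != x].
(* Lexicographic order in base [#|I|.+1]: first the number of values other than [x], then the number
   of missing inputs. *)
pose rho u := #|D u| * #|I|.+1 + (#|I| - #|u|).
have rhoD u : rho u %/ #|I|.+1 = #|D u|.
  by rewrite /rho divnMDl // divn_small ?addn0 // ltnS leq_subr.
have DS u v : u \subset v -> D u \subset D v.
  by move=> uv; apply/subsetP=> p; rewrite !inE => /andP[/(subsetP uv)-> ->].
have Dsub u : D u \subset u by apply/subsetP=> p; rewrite inE => /andP[].
pose fill u := u :|: [set p | (p.2 == x) && (p.1 \notin dom u)].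
have fill_pf u : partial_fun u -> partial_fun (fill u).
  move=> /partial_funP pu; apply/partial_funP=> p q.
  rewrite !inE => /orP[pu'|/andP[/eqP px pd]] /orP[qu|/andP[/eqP qx qd]] pq.
  - exact: pu.
  - by case/imsetP: qd; exists p.
  - by case/imsetP: pd; exists q.
  - by case: p q px qx pq {pd qd} => [? ?] [? ?] /= -> -> ->.
have fill_dom u : dom (fill u) = setT.
  apply/setP=> a; rewrite inE; have [/imsetP[p pu ->]|ad] := boolP (a \in dom u).
    by apply: imset_f; rewrite inE pu.
  by apply/imsetP; exists (a, x); rewrite // !inE eqxx ad orbT.
have fill_card u : partial_fun u -> #|fill u| = #|I|.
  by move=> pu; rewrite -card_dom ?fill_pf // fill_dom cardsT.
have fillD u : D (fill u) = D u.
  by apply/setP=> p; rewrite !inE; case: (p.2 == x); rewrite ?andbF // orbF.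
have fill_in u : u \in inputs k tau -> fill u \in inputs k tau.
  rewrite !inE => /and3P[pu tu cu]; rewrite fill_pf // fill_card // leq_addr andbT /=.
  apply/subsetP=> y /imsetP[p]; rewrite !inE => /orP[pu'|/andP[/eqP px _]] ->.
    by apply: (subsetP tu); apply: imset_f.
  by rewrite px.
pose W0 := [set u in inputs k tau | D u == set0].
apply: (@acyclic_build _ _ (@nested_sym _) _ rho W0).
- by apply/subsetP=> u; rewrite inE => /andP[].
- apply: (@acyclic_cone _ _ (@nested_sym _) (fill set0)).
    rewrite !inE fillD fill_pf ?fill_card ?leq_addr /=; last first.
    - by apply/partial_funP=> p q; rewrite inE.
    - by apply/partial_funP=> p q; rewrite inE.
    rewrite andbT; apply/andP; split; last by apply/eqP/setP=> p; rewrite !inE.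
    by apply/subsetP=> y /imsetP[p]; rewrite !inE => /andP[/eqP px _] ->; rewrite px.
  move=> u; rewrite inE => /andP[_ /eqP Du] _; rewrite /nested; apply/orP; right.
  apply/subsetP=> p pu; rewrite !inE /dom imset0 inE andbT.
  by have /setP/(_ p) := Du; rewrite !inE pu => /negbFE.
- move=> u v /setDP[uQ _] /setDP[vQ _] ruv; apply: contraNN => /nested_card_inj uv.
  apply/eqP; apply: uv; move: uQ vQ; rewrite !inE => /and3P[pu _ _] /and3P[pv _ _].
  move: (ruv); rewrite /rho -!rhoD ruv => /addnI e.
  by rewrite -(subKn (card_partial_fun pu)) e subKn // card_partial_fun.
move=> u /setDP[uQ]; rewrite inE uQ /= => Du.
move: (uQ); rewrite inE => /and3P[pu tu cu].
move: (card_partial_fun pu); rewrite leq_eqVlt => /orP[/eqP full|notfull].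
  (* Above a total [u] there is nothing; below it, a smaller [rho] means losing an element of [D u],
     so the lower link is an interval from [set0]. *)
  apply: (@eq_ind _ _ (acyclic _ k)).
    apply: (@acyclic_interval _ k set0 u (D u)); rewrite ?sub0set ?Dsub //.
    by rewrite subset0.
  apply/setP=> v; rewrite [LHS]inE [RHS]inE sub0set /=; apply/idP/idP.
    case/and3P=> vu cv Dv.
    have vQ : v \in inputs k tau.
      rewrite inE (partial_fun_sub vu pu) (subset_trans (imsetS _ vu) tu) /= -full.
      by rewrite -(cardsID v u) (setIidPr vu) leq_add2l.
    rewrite vQ /nested vu orbT /=; apply/andP; split.
      by apply: contraNneq Dv => ->.
    have ltD : #|D v| < #|D u|.
      apply: proper_card; rewrite properE DS //=; apply: contra Dv => sD.
      exact: subset_trans sD (Dsub v).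
    apply/orP; right; apply: (@leq_trans (#|D v|.+1 * #|I|.+1)).
      by rewrite /rho mulSn addnC ltn_add2r ltnS leq_subr.
    by rewrite /rho (leq_trans _ (leq_addr _ _)) // leq_pmul2r.
  case/and4P=> vQ vu cuv h.
  have vsu : v \subset u.
    case/orP: cuv => // uv; rewrite -(_ : u = v) //; apply/eqP.
    rewrite eqEcard uv full card_partial_fun //.
    by move: vQ; rewrite inE => /and3P[].
  rewrite vsu /=; apply/andP; split.
    move: vQ; rewrite inE => /and3P[_ _]; rewrite -full -(cardsID v u) (setIidPr vsu).
    by rewrite leq_add2l.
  apply/negP=> sD; have eD : D v = D u.
    apply/eqP; rewrite eqEsubset DS //=; apply/subsetP=> p pD.
    by move: (pD); rewrite !inE (subsetP sD) // => /andP[_ ->].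
  move: h; rewrite inE vQ eD (negPf Du) /= /rho eD full subnn addn0.
  by rewrite ltnNge leq_addr.
(* A lower neighbour [v] containing [u] has [D v = D u], hence adds only values [x] and lies in
   [fill u]. *)
apply: (@acyclic_cone _ _ (@nested_sym _) (fill u)).
  rewrite inE fill_in //= /nested subsetUl /=; apply/andP; split.
    by apply: contraTneq notfull => <-; rewrite fill_card // ltnn.
  by rewrite /rho fillD fill_card // subnn addn0 -{1}[_ * _]addn0 ltn_add2l subn_gt0 notfull orbT.
move=> v; rewrite inE => /and4P[vQ vu cuv h] _; rewrite /nested; apply/orP; right.
case/orP: cuv => [uv|vsu]; last exact: subset_trans vsu (subsetUl _ _).
have Dv : D v != set0.
  by apply: contraNneq Du => Dv; rewrite -subset0 -Dv DS.
move: h; rewrite inE vQ (negPf Dv) /= => /ltnW/(leq_div2r #|I|.+1).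
rewrite !rhoD => le_D; have eD : D u = D v by apply/eqP; rewrite eqEcard DS.
have /partial_funP pv : partial_fun v by move: vQ; rewrite inE => /and3P[].
apply/subsetP=> p pv'; rewrite !inE.
have [px|px] := eqVneq p.2 x; last first.
  have : p \in D v by rewrite inE pv'.
  by rewrite -eD inE => /andP[->].
have [/imsetP[q qu pq]|] := boolP (p.1 \in dom u); last by rewrite orbT.
by rewrite (pv p q) ?qu // (subsetP uv).
Qed.

(** Cliques are partial executions: at most one view per process, and all views nested. *)
Definition exec_adj (p q : I * {set I * J}) :=
  (p.1 != q.1) && nested p.2 q.2.

Lemma exec_adj_sym : symmetric exec_adj.
Proof. by move=> p q; rewrite /exec_adj eq_sym nested_sym. Qed.

(* Deleting the vertexes of color [b] other than [(b, t)] leaves a cone of apex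
   [(b, t)], and their links are of the same form without the color [b]. *)
Lemma acyclic_views (C : {set I}) (U : {set {set I * J}}) t :
  t \in U -> {in U, forall u, u \subset t} -> C \subset dom t ->
  acyclic exec_adj #|C|
    [set p | [&& p.1 \in C, p.1 \in dom p.2 & p.2 \in U]].
Proof.
have [m] := ubnP #|C|; elim: m => // m IHm in C U *; rewrite ltnS => leC tU topt Ct.
have [->|/set0Pn[b bC]] := eqVneq C set0; first by rewrite cards0.
rewrite (cardsD1 b) bC add1n; set W := [set p | _].
have ltC : #|C :\ b| < m.
  by apply: leq_trans leC; rewrite [X in _ < X](cardsD1 b) bC.
pose W0 := [set p in W | (p.1 == b) ==> (p.2 == t)].
(* A constant rank suffices: the added vertexes all have color [b], so no two are adjacent. *)
apply: (@acyclic_build _ _ exec_adj_sym _ (fun=> 0) W0).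
- by apply/subsetP=> p; rewrite inE => /andP[].
- apply: (@acyclic_cone _ _ exec_adj_sym (b, t)).
    by rewrite !inE /= bC tU !eqxx (subsetP Ct).
  case=> a u; rewrite !inE /exec_adj /= => /andP[/and3P[_ _ uU] h] ne.
  rewrite /nested topt // orbT andbT.
  by apply: contraNneq ne => ba; move: h; rewrite -ba eqxx /= => /eqP ->.
- move=> p q /setDP[pW pW0] /setDP[qW qW0] _ _.
  move: pW0 qW0; rewrite inE pW negb_imply => /andP[/eqP pb _].
  rewrite inE qW negb_imply => /andP[/eqP qb _].
  by rewrite /exec_adj pb qb eqxx.
case=> a u /setDP[pW pW0].
have [ab uU] : a = b /\ u \in U.
  move: pW0; rewrite inE pW negb_imply => /andP[/eqP /= -> _].
  by move: pW; rewrite inE => /and3P[].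
subst a.
apply: (@eq_ind _ _ (acyclic exec_adj #|C :\ b|)).
  apply: (IHm (C :\ b) [set v in U | nested u v]) => //.
  - by rewrite inE tU /nested topt.
  - by move=> v; rewrite inE => /andP[/topt].
  - exact: subset_trans (subD1set _ _) Ct.
apply/setP=> -[a v]; rewrite !inE /exec_adj /= xpair_eqE.
rewrite [b == a]eq_sym; case: (eqVneq a b) => [->|ab] /=; first by rewrite !andbF.
rewrite ltnn orbF andbT -!andbA; case: (a \in C) => //=.
by case: (a \in dom v); case: (v \in U); case: (nested u v).
Qed.

(** For a nonempty chain [s] this is the interval from its least to its greatest element; the
    existential form makes monotonicity in [s] immediate. *)
Definition between (s : {set {set I * J}}) : {set {set I * J}} :=
  [set u : {set I * J} | [exists l in s, l \subset u] && [exists h in s, u \subset h]].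

(** The condition on [dom] is the counterpart of [a \in S a]: a process sees its own input. *)
Definition views (U : {set {set I * J}}) : {set I * {set I * J}} :=
  [set p | (p.1 \in dom p.2) && (p.2 \in U)].

Lemma clique_top (s : {set {set I * J}}) : clique (@nested _) s -> s != set0 ->
  exists2 t, t \in s & {in s, forall u, u \subset t}.
Proof.
move=> /cliqueP cl /set0Pn[u0 u0s].
have [t ts maxt] := @arg_maxnP _ u0 (fun u => u \in s) (fun u => #|u|) u0s.
exists t => // u us; have [->//|ut] := eqVneq u t.
case/orP: (cl _ _ us ts ut) => // tu; rewrite -(_ : t = u) //.
by apply/eqP; rewrite eqEcard tu; apply: maxt.
Qed.

(** Members of a chain have distinct sizes, here between 1 and [#|t|]. *)
Lemma card_clique (s : {set {set I * J}}) t : clique (@nested _) s ->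
  {in s, forall u, u \subset t} -> set0 \notin s -> #|s| <= #|t|.
Proof.
move=> /cliqueP cl topt s0; rewrite cardE -(size_map (fun u : {set I * J} => #|u|)).
rewrite -[X in _ <= X](size_iota 1); apply: uniq_leq_size.
  rewrite map_inj_in_uniq ?enum_uniq // => u v; rewrite !mem_enum => us vs cuv.
  by apply: contraTeq isT => uv; case/eqP: (uv); apply: nested_card_inj cuv; apply: cl.
move=> i /mapP[u]; rewrite mem_enum => us ->; rewrite mem_iota add1n ltnS.
rewrite (subset_leq_card (topt u us)) andbT card_gt0.
by apply: contraNneq s0 => <-.
Qed.

(** The greatest element [t] serves as apex in [acyclic_views], with [dom t] as colors;
    [card_clique] bounds [#|s|] by their number. *)
Lemma acyclic_between (s : {set {set I * J}}) :
  clique (@nested _) s -> s != set0 -> set0 \notin s ->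
  {in s, forall u, partial_fun u} ->
  acyclic exec_adj #|s| (views (between s)).
Proof.
move=> cl s0 n0 pf; have [t ts topt] := clique_top cl s0.
apply: (@acyclic_le _ _ _ #|dom t|); first by rewrite card_dom ?pf // card_clique.
apply: (@eq_ind _ _ (acyclic exec_adj #|dom t|)).
  apply: (@acyclic_views (dom t) (between s) t) => //.
    by rewrite inE; apply/andP; split; apply/exists_inP; exists t.
  by move=> u; rewrite inE => /andP[_ /exists_inP[h /topt ht uh]]; apply: subset_trans ht.
apply/setP=> -[a u]; rewrite !inE /=; apply/idP/idP; first by case/andP=> _.
move=> /andP[au h]; rewrite au h andbT.
case/andP: h => _ /exists_inP[v /topt vt uv].
by rewrite andbT (subsetP (imsetS fst (subset_trans uv vt)) _ au).
Qed.

Lemma rainbow_execution k (f : I * {set I * J} -> J) tau :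
  k < #|I| -> #|tau| = k.+1 ->
  {in views (inputs k setT), forall p, f p \in snd @: p.2} ->
  exists2 s, simplex exec_adj (views (inputs k setT)) k.+1 s & f @: s = tau.
Proof.
move=> kI ctau fval.
have inputsS sigma : inputs k sigma \subset inputs k setT.
  by apply/subsetP=> u; rewrite !inE subsetT => /and3P[-> _ ->].
(* This is the range of dimensions in which [acyclic_inputs] supplies fillings. *)
pose good (sigma : {set J}) := #|sigma| <= k.+1.
have good_sub (s t : {set J}) : good t -> s \subset t -> good s.
  by move=> gt st; apply: leq_trans (subset_leq_card st) gt.
have [phi phiP] : exists phi, carried (@nested _) good (inputs k) phi.
  apply: acyclic_carrier => //.
    move=> s t st; apply/subsetP=> u; rewrite !inE => /and3P[-> su ->].
    by rewrite (subset_trans su st).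
  by move=> s gs s0; apply: acyclic_le gs _; apply: acyclic_inputs.
pose goodX (s : {set {set I * J}}) :=
  clique (@nested _) s && (s \subset inputs k setT).
have [psi psiP] : exists psi,
    carried exec_adj goodX (fun s => views (between s)) psi.
  apply: acyclic_carrier.
  - move=> s t /andP[ct tQ] st; rewrite /goodX (clique_sub st ct).
    exact: subset_trans tQ.
  - move=> s t st; apply/subsetP=> p; rewrite !inE => /and3P[-> /= hl hh].
    apply/andP; split.
      by case/exists_inP: hl => l /(subsetP st) lt lp; apply/exists_inP; exists l.
    by case/exists_inP: hh => l /(subsetP st) lt lp; apply/exists_inP; exists l.
  move=> s /andP[cl sQ] s0; apply: acyclic_between => //.
    (* Since [k < #|I|], the empty partial input misses too many processes. *)
    apply/negP=> /(subsetP sQ); rewrite inE cards0 add0n => /and3P[_ _].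
    by rewrite leqNgt kI.
  by move=> u /(subsetP sQ); rewrite inE => /and3P[].
have := @carried_comp _ _ _ _ exec_adj good goodX (inputs k) _
  (fun sigma => views (inputs k sigma)) phi psi phiP psiP.
case=> [sigma s _ /and3P[sQ cl _]|]; first split.
- by rewrite /goodX cl (subset_trans sQ).
- apply/subsetP=> p; rewrite !inE => /and3P[-> /= /exists_inP[l ls lp] /exists_inP[h hs ph]].
  have := inputs_between (subsetP sQ l ls) (subsetP sQ h hs) lp ph.
  by rewrite inE.
move=> phi0 phiP'.
have [||s sims fs] := @sperner _ _ exec_adj good (fun sigma => views (inputs k sigma))
    f _ tau good_sub _ (conj phi0 phiP').
- move=> sigma p _; rewrite inE => /andP[pd pQ].
  have pv : p \in views (inputs k setT) by rewrite inE pd (subsetP (inputsS sigma)).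
  by move: pQ; rewrite inE => /and3P[_ /subsetP h _]; apply/h/fval.
- by rewrite /good ctau.
exists s => //; move: sims; rewrite ctau => /and3P[sW cl cs].
rewrite /simplex cl cs andbT (subset_trans sW) //.
apply/subsetP=> p; rewrite !(inE, in_set) => /andP[-> /=].
by case/and3P=> -> _ ->; rewrite subsetT.
Qed.

End PartialFunctions.

Arguments inputs {I J} k tau.

(** * From morphisms to decision maps *)

Section Runs.
Variables (n : nat) (A : {set {set 'I_n.+1}}) (k : nat).
Hypotheses (hA : superset_closed_adversary A) (hkA : k < csize A).

Notation proc := 'I_n.+1.
Notation vertex := (proc * {set proc * proc})%type.

Lemma ltn_csize : k < n.+1.
Proof.
case: hA => _ A0 _; have [C _ cC] := csize_attained A0.
by rewrite (leq_trans hkA) // -cC (leq_trans (max_card _)) ?card_ord.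
Qed.

(** A hitting set contains a core, hence has more than [k] elements; so some [P] in [A] avoids [T],
    and superset closure concludes. *)
Lemma small_compl_adversary (T : {set proc}) : #|T| <= k -> ~: T \in A.
Proof.
case: hA => _ _ upA leT.
have : ~~ hitting A T.
  apply: contraL hkA => /minset_exists[C coreC CT]; rewrite -leqNgt.
  exact: leq_trans (csize_leq coreC) (leq_trans (subset_leq_card CT) leT).
case/forall_inPn=> P PA; rewrite negbK setI_eq0 => dTP.
by apply: upA PA _; rewrite -disjoints_subset disjoint_sym.
Qed.

Variable delta : (proc * proc) * vertex ->
                 (proc * proc) * (proc * proc).
Hypothesis delta_morphism :
  morphism (round_protocol A) (set_agreement_task n k) delta.
Hypothesis delta_fst : {in vertexes (round_protocol A), forall z, (delta z).1 = z.1}.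

(** The image of the facet lies in a single product facet. Its first projection is fixed by
    [delta_fst], and matching colors in the product identify the second components with [d]. *)
Lemma run_decision (g : {ffun proc -> proc}) S : S \in schedules A ->
  exists2 d, d \in decisions n k & forall a,
    (delta ((a, g a), (a, view (graph g) S a))).2.2 = d a
    /\ exists a', d a = g a'.
Proof.
move=> SA; set X := graph g; set Z := prod_facet (initial n) (round A) X (graph (view X S)).
have FX : X \in facets (initial n) by rewrite facets_graph imset_f.
have simZ : Z \in simplexes (round_protocol A).
  by apply: facet_simplex; rewrite facets_subcomplex; apply: imset2_f.
have inZ a : ((a, g a), (a, view X S a)) \in Z.
  by rewrite inE /= !imset_f //= eqxx.
have [_ /(_ Z simZ) + _] := delta_morphism.
case/downsetP=> _ /imset2P[X' d FX' + ->] /subsetP dZ.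
rewrite inE => /andP[dd /forallP valid_d].
have dP a : (a, g a) \in X' /\ (delta ((a, g a), (a, view X S a))).2.2 = d a.
  have := dZ _ (imset_f delta (inZ a)); rewrite inE delta_fst; last first.
    by apply/bigcupP; exists Z.
  case/and3P=> /= -> /imsetP[b _ e] /eqP /=; rewrite e /= => ab.
  by rewrite /= in ab; split=> //; rewrite ab.
exists d => // a; split; first by case: (dP a).
have /existsP[a' da'] := valid_d a; exists a'.
by have [] := facet_inj FX' da' (dP a').1 erefl.
Qed.

(** The input of the process is read off its own view; on [views] the default [ord0] is never
    reached. *)
Definition decision (p : vertex) : proc :=
  (delta ((p.1, odflt ord0 [pick v | (p.1, v) \in p.2]), p)).2.2.

(** Missing entries repeat the value [v0] already in [u], so no new value appears. *)
Lemma graph_extension (u : {set proc * proc}) : partial_fun u -> u != set0 ->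
  exists2 g : {ffun proc -> proc}, u \subset graph g & forall a, g a \in snd @: u.
Proof.
move=> /partial_funP pu /set0Pn[[a0 v0] u0].
exists [ffun a => odflt v0 [pick v | (a, v) \in u]].
  apply/subsetP=> -[a v] av; apply/imsetP; exists a => //; rewrite ffunE.
  case: pickP => [w aw|/(_ v)]; last by rewrite av.
  exact: (pu _ _ av aw erefl).
move=> a; rewrite ffunE; case: pickP => [w aw|_]; last exact: (imset_f snd u0).
exact: (imset_f snd aw).
Qed.

Lemma view_dom (g : {ffun proc -> proc}) (S : {ffun proc -> {set proc}}) a (u : {set proc * proc}) :
  u \subset graph g -> S a = dom u -> view (graph g) S a = u.
Proof.
move=> /subsetP ug Sa; apply/setP=> p; rewrite ffunE inE Sa.
apply/andP/idP => [[/imsetP[b _ ->] /imsetP[q qu /= ->]]|pu].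
  by have /imsetP[c _ qc] := ug q qu; move: qu; rewrite qc.
by split; [exact: ug | exact: (imset_f fst pu)].
Qed.

(** A clique is completed to one full execution: processes absent from [s] see everything, which
    keeps the schedule nested. *)
Lemma clique_run (s : {set vertex}) (g : {ffun proc -> proc}) :
  clique (@exec_adj _ _) s -> s \subset views (inputs k setT) ->
  {in s, forall p : vertex, p.2 \subset graph g} ->
  exists2 d, d \in decisions n k &
    {in s, forall p : vertex, decision p = d p.1 /\ exists a', d p.1 = g a'}.
Proof.
move=> /cliqueP cl /subsetP sQ sg.
pose S := [ffun a => if [pick p in s | p.1 == a] is Some p then dom p.2 else setT].
have s_inj p q : p \in s -> q \in s -> p.1 = q.1 -> p = q.
  move=> ps qs pq; apply: contraTeq isT => /(cl _ _ ps qs).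
  by rewrite /exec_adj pq eqxx.
have SE p : p \in s -> S p.1 = dom p.2.
  move=> ps; rewrite ffunE; case: pickP => [q /andP[qs /eqP qp]|/(_ p)].
    by rewrite (s_inj q p).
  by rewrite ps eqxx.
have SP a : (exists2 p, p \in s & a = p.1 /\ S a = dom p.2) \/ S a = setT.
  rewrite ffunE; case: pickP => [q /andP[qs /eqP qp]|_]; last by right.
  by left; exists q.
have SA : S \in schedules A.
  rewrite inE; apply/andP; split.
    apply/forallP=> a; case: (SP a) => [[p ps [-> ->]]|->]; last first.
      by rewrite inE andbT -setC0 small_compl_adversary ?cards0.
    have := sQ p ps; rewrite !inE => /and4P[-> pf _ cp]; rewrite andbT.
    rewrite -[dom _]setCK small_compl_adversary // -(leq_add2l #|dom p.2|).
    by rewrite cardsC card_dom // -[in X in X <= _](card_ord n.+1).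
  apply/forallP=> a; apply/forallP=> b.
  case: (SP a) => [[p ps [_ ->]]|->]; last by rewrite subsetT orbT.
  case: (SP b) => [[q qs [_ ->]]|->]; last by rewrite subsetT.
  have [->|/(cl _ _ ps qs)/andP[_ /orP[] pq]] := eqVneq p q; first by rewrite subxx.
    by rewrite /dom imsetS.
  by rewrite /dom [X in _ || X]imsetS ?orbT.
have [d dd dP] := run_decision g SA; exists d => // p ps.
have [dp gp] := dP p.1; split=> //; rewrite -dp (view_dom (sg p ps) (SE p ps)).
(* As [p.2] lies in [graph g], the input read off the view is [g p.1]. *)
rewrite /decision; have := sQ p ps; rewrite inE => /andP[/imsetP[q qp pq] _].
case: pickP => [v pv|/(_ q.2)]; last by rewrite pq -surjective_pairing qp.
have /imsetP[b _ [e ->]] := subsetP (sg p ps) _ pv.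
by rewrite /= -e -surjective_pairing.
Qed.

Lemma inputs_partial_fun (p : vertex) : p \in views (inputs k setT) ->
  partial_fun p.2 /\ p.2 != set0.
Proof.
rewrite inE => /andP[/imsetP[q qp _]]; rewrite inE => /andP[pf _]; split=> //.
by apply/set0Pn; exists q.
Qed.

(** Run the view alone, on an extension having no further values, so that validity of the task
    confines the decision to the view. *)
Lemma decision_valid :
  {in views (inputs k setT), forall p : vertex, decision p \in snd @: p.2}.
Proof.
move=> p pQ; have [pf p0] := inputs_partial_fun pQ.
have [g pg gv] := graph_extension pf p0.
have [|||d _ /(_ p (set11 p))[-> [a' ->]]] := @clique_run [set p] g.
- by apply/cliqueP=> q r /set1P -> /set1P ->; rewrite eqxx.
- by rewrite sub1set.
- by move=> q /set1P ->.
exact: gv.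
Qed.

(** All views lie in the largest one, so any total extension of it makes them part of a single
    execution. *)
Lemma card_decisions (s : {set vertex}) :
  clique (@exec_adj _ _) s -> s \subset views (inputs k setT) ->
  #|decision @: s| <= k.
Proof.
move=> cl sQ; have [->|s0] := eqVneq s set0; first by rewrite imset0 cards0.
have [||t /imsetP[p ps ->] topt] := @clique_top _ _ (snd @: s).
- apply/cliqueP=> _ _ /imsetP[p ps ->] /imsetP[q qs ->] pq.
  have /(cliqueP _ _ cl p q ps qs)/andP[] // : p != q by apply: contraNneq pq => ->.
- by case/set0Pn: s0 => p ps; apply/set0Pn; exists p.2; apply: imset_f.
have [pf p0] := inputs_partial_fun (subsetP sQ p ps).
have [g pg _] := graph_extension pf p0.
have [q qs|d] := @clique_run s g cl sQ.
  by apply: subset_trans pg; apply: topt; apply: imset_f.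
rewrite inE => dk dP; apply: leq_trans dk; apply/subset_leq_card/subsetP=> _ /imsetP[q qs ->].
by rewrite (dP q qs).1 imset_f.
Qed.

End Runs.

Theorem theorem4p6 (n : nat) (A : {set {set 'I_n.+1}}) (k : nat)
    (hA : superset_closed_adversary A) (hk : 0 < k) (hkA : k < csize A) :
  ~ solvable (set_agreement_task n k) (round_protocol A).
Proof.
case=> delta [delta_morphism delta_fst].
have kn := ltn_csize hA hkA.
(* Any [k.+1] values would do; [kn] guarantees that there are that many. *)
pose tau : {set 'I_n.+1} := [set a : 'I_n.+1 | a < k.+1].
have ctau : #|tau| = k.+1.
  by rewrite cardsE -[RHS](card_ord k.+1) -sum1_card (big_ord_narrow kn) sum1_card.
have [|s /and3P[sQ cl _] ds] := @rainbow_execution _ _ k (decision delta) tau _ ctau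
    (decision_valid hA hkA delta_morphism delta_fst); first by rewrite card_ord.
have := card_decisions hA hkA delta_morphism delta_fst cl sQ.
by rewrite ds ctau ltnn.
Qed.
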